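(* Let $\beta\geq\frac{1+\sqrt5}{2}$ and let $\boldsymbol{v}_{-\beta}=(v_n)_{n\in\mathbb{Z}}$ be the bidirectional infinite word over $\mathbb{N}$ associated with the $(-\beta)$-integers. There exists an antimorphism $\Phi:\mathbb{N}^*\to\mathbb{N}^*$ such that $\Psi=\Phi^2$ is a non-erasing morphism different from the identity and $\Psi(\boldsymbol{v}_{-\beta})=\boldsymbol{v}_{-\beta}$.
   Context: Let $\beta>1$, $\mathcal{A}_\beta=\{0,1,\dots,\lfloor\beta\rfloor\}$, $l_\beta=\frac{-\beta}{\beta+1}$, $r_\beta=\frac1{\beta+1}$, $I_\beta=[l_\beta,r_\beta)$, $T_{-\beta}(x)=-\beta x-\lfloor -\beta x+\frac{\beta}{\beta+1}\rfloor$ on $I_\beta$. The $(-\beta)$-expansion of $x\in I_\beta$ is $x_1x_2\cdots$ with $x_i=\lfloor -\beta T_{-\beta}^{i-1}(x)+\frac{\beta}{\beta+1}\rfloor$; an infinite string over $\mathcal{A}_\beta$ is $(-\beta)$-admissible if it is the expansion of some $x\in I_\beta$. Alternate order: $x_1x_2\cdots\prec_{\mathrm{alt}}y_1y_2\cdots$ if $(-1)^i(y_i-x_i)>0$ for the smallest $i$ with $x_i\ne y_i$. For a finite string $u=a_k\cdots a_0$, $\gamma(u)=\sum a_i(-\beta)^i$. $\mathbb{Z}_{-\beta}=\{\gamma(a_k\cdots a_0): a_k\cdots a_00^\omega\text{ admissible}\}$ ($0^\omega$ infinite repetition of $0$). For $k\ge0$, $\mathcal{S}(k)$ is the set of admissible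 strings $a_{k-1}\cdots a_00^\omega$, with alternate-order maximum $\mathrm{Max}(k)=\max(k)0^\omega$ and minimum $\mathrm{Min}(k)=\min(k)0^\omega$ ($\max(k),\min(k)$ of length $k$). Let $(z_n)_{n\in\mathbb{Z}}$ be the strictly increasing enumeration of $\mathbb{Z}_{-\beta}$ with $z_0=0$. Fact: for each $n$ there is a unique $k\in\mathbb{N}$ such that for some digit $d\ge1$ and finite string $w$ over $\mathcal{A}_\beta$ beginning with $0$, the strings $w(d-1)\mathrm{Max}(k)$, $wd\,\mathrm{Min}(k)$ are admissible and $\{z_n,z_{n+1}\}=\{\gamma(w(d-1)\max(k)),\gamma(wd\min(k))\}$; one sets $v_n=k$ (equivalently, $v_n$ is the largest exponent at which the digits of the admissible representations of $z_n$ and $z_{n+1}$ differ). An antimorphism is a map $\Phi:\mathcal{B}^*\to\mathcal{B}^*$ with $\Phi(uw)=\Phi(w)\Phi(u)$; a morphism $\Psi$ satisfies $\Psi(uw)=\Psi(u)\Psi(w)$ and acts on pointed bidirectional words by $\Psi(\cdots w_{-2}w_{-1}|w_0w_1\cdots)=\cdots\Psi(w_{-2})\Psi(w_{-1})|\Psi(w_0)\Psi(w_1)\cdots$. Non-erasing means $\Psi(a)\ne\epsilon$ for every letter $a$. *)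

(* Defs.v *)
From mathcomp Require Import all_boot all_order all_algebra.
From mathcomp Require Import all_classical all_reals.

Set Implicit Arguments.
Unset Strict Implicit.
Unset Printing Implicit Defensive.

Import Order.TTheory GRing.Theory Num.Theory.

Local Open Scope classical_set_scope.
Local Open Scope ring_scope.

Section NegativeBase.
Context {R : realType}.
Variable beta : R.

Definition l_ : R := - beta / (beta + 1).
Definition r_ : R := 1 / (beta + 1).
Definition I_ : set R := [set x | l_ <= x < r_].

Definition digit (x : R) : int := Num.floor (- beta * x + beta / (beta + 1)).
Definition T_ (x : R) : R := - beta * x - (digit x)%:~R.

(* Infinite strings x_1 x_2 ... are 0-indexed: s i is the digit x_(i+1). *)
Definition expansion (x : R) : nat -> int := fun i => digit (iter i T_ x).

Definition alphabet : set int := [set a | 0 <= a <= Num.floor beta].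

Definition admissible (s : nat -> int) : Prop :=
  (forall i, alphabet (s i)) /\ exists2 x, I_ x & expansion x = s.

(* The sign is (-1)^(i+1) because of the 0-indexing. *)
Definition alt_lt (x y : nat -> int) : Prop :=
  exists2 i : nat, (forall j, (j < i)%N -> x j = y j) &
                   0 < (-1) ^+ i.+1 * (y i - x i).

(* A finite string a_k ... a_0 is the list [:: a_k; ...; a_0]; pad0 u is the
   infinite string u0^omega (0 being the default value of _`_i). *)
Definition pad0 (u : seq int) : nat -> int := fun i => u`_i.

Definition gamma (u : seq int) : R :=
  \sum_(i < size u) ((rev u)`_i)%:~R * (- beta) ^+ i.

Definition beta_integers : set R :=
  [set x | exists u, [/\ u != [::], admissible (pad0 u) & x = gamma u]].

(* S(k), each u0^omega in it being represented by its prefix u of length k. *)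
Definition S_ (k : nat) : set (seq int) :=
  [set u | size u = k /\ admissible (pad0 u)].

Definition is_max (k : nat) (M : seq int) : Prop :=
  S_ k M /\ forall u, S_ k u -> u = M \/ alt_lt (pad0 u) (pad0 M).

Definition is_min (k : nat) (m : seq int) : Prop :=
  S_ k m /\ forall u, S_ k u -> u = m \/ alt_lt (pad0 m) (pad0 u).

Definition enumerates_beta_integers (z : int -> R) : Prop :=
  [/\ {homo z : m n / m < n}, z 0 = 0 & range z = beta_integers].

Definition gap_exponent (z : int -> R) (n : int) (k : nat) : Prop :=
  exists (d : int) (w M m : seq int),
    [/\ alphabet d /\ 1 <= d,
        (forall a, a \in w -> alphabet a) /\ ohead w = Some 0,
        is_max k M /\ is_min k m,
        admissible (pad0 (w ++ (d - 1) :: M)) /\ admissible (pad0 (w ++ d :: m)) &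
        [set z n; z (n + 1)] =
          [set gamma (w ++ (d - 1) :: M); gamma (w ++ d :: m)]].

Definition is_word_of_beta_integers (v : int -> nat) : Prop :=
  exists2 z, enumerates_beta_integers z & forall n, gap_exponent z n (v n).

End NegativeBase.

Section Words.
Context {B : eqType}.
Implicit Types Phi Psi : seq B -> seq B.

Definition antimorphism Phi : Prop :=
  forall u w, Phi (u ++ w) = Phi w ++ Phi u.

Definition morphism Psi : Prop :=
  forall u w, Psi (u ++ w) = Psi u ++ Psi w.

Definition non_erasing Psi : Prop := forall a : B, Psi [:: a] != [::].

(* Pointed bidirectional words ... w_(-2) w_(-1) | w_0 w_1 ... are functions
   w : int -> B.  When Psi is non-erasing, Psi(w_0)...Psi(w_m) and
   Psi(w_(-m-1))...Psi(w_(-1)) have length at least m+1, so that the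
   letters at positions m and -(m+1) of the image are determined by them and the
   default letter of nth is never used. (Negz i is the integer -(i+1).) *)
Definition bi_image Psi (w : int -> B) : int -> B := fun n =>
  match n with
  | Posz m => nth (w n) (flatten [seq Psi [:: w (Posz i)] | i <- iota 0 m.+1]) m
  | Negz m =>
      nth (w n)
        (rev (flatten [seq Psi [:: w (Negz i)] | i <- rev (iota 0 m.+1)])) m
  end.

End Words.

(* Main.v *)
(** The exponent k attached to a gap (a, b) determines the set of beta-integers
    between -beta a and -beta b up to translation. Indeed, after scaling, the
    expansions of a and b share a prefix w, then read d-1 and d, and end in
    max(k) and min(k). Prefix cylinders are intervals on which an iterate of T
    is affine, so for y between a and b the digits of y minus those of a depend
    only on y - a and k, and so does the tail of y. Hence multiplying by -beta
    replaces a gap k by a word phi(k) of gaps and reverses the order: k |-> phi(k)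
    extends to the antimorphism. Its square corresponds to multiplication by
    beta^2, which fixes 0 and moves every other beta-integer. *)

Require Import Defs.
From mathcomp Require Import all_boot all_order all_algebra.
From mathcomp Require Import all_classical all_reals.
From mathcomp Require Import ring lra zify.

Set Implicit Arguments.
Unset Strict Implicit.
Unset Printing Implicit Defensive.

Import Order.TTheory GRing.Theory Num.Theory.

Local Open Scope ring_scope.

(** * The map [T_] and the expansions it produces *)

Section Transformation.
Context {R : realType}.
Variable beta : R.
Hypothesis beta_gt1 : 1 < beta.

Let beta1_gt0 : 0 < beta + 1.
Proof. by have b1 := beta_gt1; lra. Qed.

Let beta1_neq0 : beta + 1 != 0.
Proof. by rewrite gt_eqF. Qed.

Let nbeta_neq0 : - beta != 0.
Proof. by have b1 := beta_gt1; rewrite lt_eqF //; lra. Qed.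

Let nbetaX_neq0 n : (- beta) ^+ n != 0.
Proof. by rewrite expf_neq0. Qed.

Lemma r_l : r_ beta = l_ beta + 1.
Proof. by rewrite /r_ /l_; field. Qed.

Lemma l_r : l_ beta = - beta * r_ beta.
Proof. by rewrite /r_ /l_; field. Qed.

Lemma r_gt0 : 0 < r_ beta.
Proof. by rewrite /r_ divr_gt0. Qed.

Lemma digitE x : digit beta x = Num.floor (- beta * x - l_ beta).
Proof. by rewrite /digit /l_ [- beta / _]mulNr opprK. Qed.

Lemma T_E x : T_ beta x = - beta * x - (digit beta x)%:~R.
Proof. by []. Qed.

Lemma T_I x : I_ beta (T_ beta x).
Proof.
rewrite /I_ /= T_E digitE r_l; set y := - beta * x.
have := floor_itv (y - l_ beta); rewrite intrD1 => /andP[h1 h2]; apply/andP; split; lra.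
Qed.

Lemma iter_T_I n x : I_ beta x -> I_ beta (iter n (T_ beta) x).
Proof. by case: n => // n _; exact: T_I. Qed.

Lemma digit_alphabet x : I_ beta x -> alphabet beta (digit beta x).
Proof.
move=> /= /andP[lx xr]; have r0 := r_gt0; have lr := l_r; have rl := r_l; have b1 := beta_gt1.
rewrite /alphabet /= digitE; apply/andP; split.
  by rewrite floor_ge0; nra.
by apply: le_floor; nra.
Qed.

Lemma digit0_itv x : I_ beta (- beta * x) -> digit beta x = 0.
Proof.
move=> /andP[lx xr]; have rl := r_l.
by rewrite digitE; apply: floor_def; rewrite /= mulr0z ; apply/andP; split; lra.
Qed.

Lemma zero_I : I_ beta 0.
Proof. by have r0 := r_gt0; have rl := r_l; have lr := l_r; have b1 := beta_gt1; rewrite /I_ /=; apply/andP; split; nra. Qed.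

Lemma digit_0 : digit beta 0 = 0.
Proof. by apply: digit0_itv; rewrite mulr0; exact: zero_I. Qed.

Lemma iter_T0 n : iter n (T_ beta) 0 = 0.
Proof. by elim: n => //= n ->; rewrite T_E digit_0 mulr0 subr0. Qed.

Lemma expansion_iter j x i :
  expansion beta (iter j (T_ beta) x) i = expansion beta x (i + j).
Proof. by rewrite /expansion iterD. Qed.

Lemma iter_T_small n x : (forall i, expansion beta x i = 0) ->
  iter n (T_ beta) x = (- beta) ^+ n * x.
Proof.
move=> x0; elim: n => [|n IH] /=; first by rewrite mul1r.
by rewrite T_E -[digit _ _]/(expansion beta x n) x0 subr0 IH exprS mulrA.
Qed.

(** Zero digits make [T_] act as multiplication by [-beta], and an orbit growing like [beta ^ n]
    leaves the bounded set [I_] unless it starts at 0. *)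
Lemma expansion_eq0 x : I_ beta x -> (forall i, expansion beta x i = 0) -> x = 0.
Proof.
have b1 := beta_gt1.
move=> xI x0; apply/eqP; rewrite -[_ == _]negbK; apply/negP => xn0.
(* Bernoulli's inequality for [beta ^ n], played against the bound 1 on [I_]. *)
have bnd n : (1 + (beta - 1) * n%:R) * `|x| <= 1.
  have le1 : `|iter n (T_ beta) x| <= 1.
    have /andP[lT Tr] := iter_T_I n xI.
    have r0 := r_gt0; have lr := l_r; have rl := r_l.
    by rewrite ler_norml; apply/andP; split; nra.
  apply: le_trans le1; rewrite iter_T_small // normrM normrX normrN.
  rewrite (gtr0_norm (_ : 0 < beta)); last by lra.
  apply: ler_wpM2r => //.
  elim: n => [|n IH]; first by rewrite mulr0 addr0.
  rewrite exprS -natr1; have n0 : 0 <= (beta - 1) ^+ 2 * n%:R by rewrite mulr_ge0 ?sqr_ge0.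
  have := ler_wpM2l (_ : 0 <= beta) IH; lra.
have x_gt0 : 0 < `|x| by rewrite normr_gt0.
have c_gt0 : 0 < (beta - 1) * `|x| by apply: mulr_gt0 => //; lra.
have [n] : exists n : nat, 1 / ((beta - 1) * `|x|) < n%:R.
  exists (Num.truncn (1 / ((beta - 1) * `|x|))).+1.
  exact: truncnS_gt.
rewrite ltr_pdivrMr // => ltn; have bn := bnd n; nra.
Qed.

(** * Beta-integers scaled into [I_] *)

Definition scale (L : nat) (z : R) := z / (- beta) ^+ L.

Lemma scale_addn L j z : scale (L + j) z = scale L z / (- beta) ^+ j.
Proof. by rewrite /scale exprD invfM mulrA. Qed.

(** Position [j] of the expansion of [scale L z] carries the exponent [L - 1 - j]; multiplying by
    [-beta] raises all exponents by one and keeps the point. *)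
Lemma scaleS L z : scale L.+1 (- beta * z) = scale L z.
Proof. by rewrite /scale exprS invfM mulrACA divff // mul1r. Qed.

Lemma gamma_cons a u : gamma beta (a :: u) = a%:~R * (- beta) ^+ size u + gamma beta u.
Proof.
rewrite /gamma /= big_ord_recr /= addrC; congr (_ + _).
  by rewrite rev_cons nth_rcons size_rev ltnn eqxx.
by apply: eq_bigr => i _; rewrite rev_cons nth_rcons size_rev ltn_ord.
Qed.

Lemma iter_T_gamma u x : (forall i, (i < size u)%N -> expansion beta x i = u`_i) ->
  iter (size u) (T_ beta) x = (- beta) ^+ size u * x - gamma beta u.
Proof.
elim: u x => [|a u IH] x xu.
  by rewrite /gamma big_ord0 mul1r subr0.
rewrite [size _]/= iterSr IH; last first.
  by move=> i iu; rewrite (expansion_iter 1) addn1 xu.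
rewrite T_E -[digit _ _]/(expansion beta x 0) xu // gamma_cons exprS /=; ring.
Qed.

(** Only zero digits follow [u], so the orbit has reached 0 by [expansion_eq0], and the affine
    formula for the iterate can be solved for [x]. *)
Lemma gamma_expansion u x : I_ beta x -> expansion beta x = pad0 u ->
  x = scale (size u) (gamma beta u) /\ iter (size u) (T_ beta) x = 0.
Proof.
move=> xI xu.
have T0 : iter (size u) (T_ beta) x = 0.
  apply: expansion_eq0; first exact: iter_T_I.
  by move=> i; rewrite expansion_iter xu /pad0 nth_default // leq_addl.
split=> //; rewrite /scale.
have := @iter_T_gamma u x; rewrite T0 xu => /(_ (fun i _ => erefl)) /eqP.
by rewrite eq_sym subr_eq0 => /eqP <-; rewrite mulrAC divff ?mul1r.
Qed.

(** Once the orbit is at 0 all later digits vanish, so the first [L] digits form an admissible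
    string representing [z]. *)
Lemma mem_beta_integers L z : (0 < L)%N -> I_ beta (scale L z) ->
  iter L (T_ beta) (scale L z) = 0 -> beta_integers beta z.
Proof.
move=> L0 tI T0; exists (mkseq (expansion beta (scale L z)) L).
have size_u := size_mkseq (expansion beta (scale L z)) L.
split.
- by rewrite -size_eq0 size_u -lt0n.
- have pad0E : expansion beta (scale L z) = pad0 (mkseq (expansion beta (scale L z)) L).
    apply/funext => i; rewrite /pad0; case: (ltnP i L) => iL; first by rewrite nth_mkseq.
    rewrite nth_default ?size_u // -(subnK iL) -expansion_iter T0.
    by rewrite /expansion iter_T0 digit_0.
  rewrite -pad0E; split; last by exists (scale L z).
  by move=> i; apply: digit_alphabet; exact: iter_T_I.
- have := @iter_T_gamma (mkseq (expansion beta (scale L z)) L) (scale L z).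
  rewrite size_u T0 => /(_ (fun i iL => esym (nth_mkseq _ _ iL))) /eqP.
  by rewrite eq_sym subr_eq0 => /eqP <-; rewrite /scale mulrCA divff ?mulr1.
Qed.

(** A first digit 0 excludes the endpoint [l_], whose quotient by [-beta] is the missing endpoint
    [r_]. Central points can thus be divided by [-beta] repeatedly, each time prepending a digit
    0. *)
Definition central (x : R) := I_ beta x /\ digit beta x = 0.

Lemma central_shift x : central x ->
  central (x / - beta) /\ T_ beta (x / - beta) = x.
Proof.
move=> [xI x0].
have mulK : - beta * (x / - beta) = x by rewrite mulrCA divff ?mulr1.
have d0 : digit beta (x / - beta) = 0 by apply: digit0_itv; rewrite mulK.
split; last by rewrite T_E d0 subr0 mulK.
split=> //.
have : I_ beta (T_ beta x) by exact: T_I.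
rewrite T_E x0 subr0 /I_ /= => /andP[h1 h2]; move: xI => /andP[h3 h4].
have r0 := r_gt0; have lr := l_r; have rl := r_l; have b1 := beta_gt1.
move: mulK; set y := x / - beta => mulK; apply/andP; split; nra.
Qed.

Lemma central_scale L j z : central (scale L z) ->
  central (scale (L + j) z) /\ iter j (T_ beta) (scale (L + j) z) = scale L z.
Proof.
move=> cL; elim: j => [|j [cj ij]]; first by rewrite addn0.
have [cj1 ij1] := central_shift cj.
by rewrite addnS -addn1 scale_addn expr1 iterSr ij1.
Qed.

Lemma expansion_central L j z i : central (scale L z) ->
  (i < j)%N -> expansion beta (scale (L + j) z) i = 0.
Proof.
move=> cL ij; have [c1 _] := central_scale (j - i) cL.
have [_] := central_scale i c1.
by rewrite -addnA subnK 1?ltnW // /expansion => ->; case: c1.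
Qed.

(** * Cylinders and translations between them *)

Lemma scaleB L x y : scale L (x - y) = scale L x - scale L y.
Proof. by rewrite /scale mulrBl. Qed.

Lemma scaleD L x y : scale L (x + y) = scale L x + scale L y.
Proof. by rewrite /scale mulrDl. Qed.

Lemma scale_inj L : injective (scale L).
Proof. by apply: mulIf; rewrite invr_eq0. Qed.

Lemma scale_between L a b y : (y - a) * (y - b) <= 0 ->
  (scale L y - scale L a) * (scale L y - scale L b) <= 0.
Proof.
move=> yab; rewrite -!scaleB /scale mulrACA.
by apply: mulr_le0_ge0 => //; exact: sqr_ge0.
Qed.

(** The digit is monotone in the point, so it is constant between two points with equal digits,
    where [T_] is affine of slope [-beta]. Betweenness is written as a product because each step
    reverses the order. *)
Lemma common_prefix q x0 x1 x :
  I_ beta x0 -> I_ beta x1 ->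
  (forall i, (i < q)%N -> expansion beta x1 i = expansion beta x0 i) ->
  (x - x0) * (x - x1) <= 0 ->
  [/\ I_ beta x,
      forall i, (i < q)%N -> expansion beta x i = expansion beta x0 i &
      iter q (T_ beta) x - iter q (T_ beta) x0 = (- beta) ^+ q * (x - x0)].
Proof.
have b1 := beta_gt1.
elim: q x0 x1 x => [|q IH] x0 x1 x I0 I1 e01 x01.
  split=> //; last by rewrite mul1r.
  move: I0 I1; rewrite /I_ /= => /andP[? ?] /andP[? ?]; apply/andP.
  by case: (lerP x x0) => xx0; split; nra.
have [xI _ _] := IH x0 x1 x I0 I1 (fun i iq => e01 i (leqW iq)) x01.
have d01 : digit beta x1 = digit beta x0 by exact: (e01 0).
have dx : digit beta x = digit beta x0.
  apply/eqP; rewrite eq_le; apply/andP; split.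
    case: (lerP x0 x) => xx0; first by rewrite !digitE; apply: le_floor; nra.
    by rewrite -d01 !digitE; apply: le_floor; nra.
  case: (lerP x x0) => xx0; first by rewrite !digitE; apply: le_floor; nra.
  by rewrite -d01 !digitE; apply: le_floor; nra.
have Tx01 : (T_ beta x - T_ beta x0) * (T_ beta x - T_ beta x1) <= 0.
  by rewrite !T_E dx d01; nra.
have eT i : (i < q)%N -> expansion beta (T_ beta x1) i = expansion beta (T_ beta x0) i.
  by move=> iq; rewrite !(expansion_iter 1) addn1 e01.
have [_ ex Tx] := IH _ _ _ (T_I x0) (T_I x1) eT Tx01.
split=> //.
  move=> [|i] iq; first exact: dx.
  by have := ex i iq; rewrite !(expansion_iter 1) addn1.
by rewrite !iterSr Tx !T_E dx exprSr; ring.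
Qed.

(** [D] involves only [y - y0] and the image of [y0]: pairs agreeing in these data have the same
    digit change and the same image. *)
Lemma T_shift (y y0 : R) : let D := - beta * (y - y0) + T_ beta y0 in
  digit beta y = digit beta y0 + Num.floor (D - l_ beta) /\
  T_ beta y = D - (Num.floor (D - l_ beta))%:~R.
Proof.
move=> D.
have dy : digit beta y = digit beta y0 + Num.floor (D - l_ beta).
  rewrite digitE; apply: floor_def.
  have := floor_itv (D - l_ beta); rewrite !intrD1 intrD => /andP[h1 h2].
  by move: h1 h2; rewrite /D T_E /l_ => h1 h2; apply/andP; split; lra.
by split=> //; rewrite T_E dy intrD /D T_E; ring.
Qed.

(** Before [q] the digits are those of the ends, at [q] they are governed by [T_shift], and after
    [q] the orbits coincide. The two prefixes themselves may differ. *)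
Lemma cylinder_translation q x0 x1 x0' x1' x :
  I_ beta x0 -> I_ beta x1 -> I_ beta x0' -> I_ beta x1' ->
  (forall i, (i < q)%N -> expansion beta x1 i = expansion beta x0 i) ->
  (forall i, (i < q)%N -> expansion beta x1' i = expansion beta x0' i) ->
  expansion beta x1 q = expansion beta x0 q + 1 ->
  expansion beta x1' q = expansion beta x0' q + 1 ->
  iter q.+1 (T_ beta) x0 = iter q.+1 (T_ beta) x0' ->
  iter q.+1 (T_ beta) x1 = iter q.+1 (T_ beta) x1' ->
  (x - x0) * (x - x1) <= 0 ->
  let x' := x - x0 + x0' in
  [/\ x1 - x0 = x1' - x0', I_ beta x, I_ beta x',
      forall j, expansion beta x j =
        expansion beta x' j + (expansion beta x0 j - expansion beta x0' j) &
      iter q.+1 (T_ beta) x = iter q.+1 (T_ beta) x'].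
Proof.
move=> I0 I1 I0' I1' e e' d d' T0 T1 x01 x'.
have between1 (a b : R) : (b - a) * (b - b) <= 0 by rewrite subrr mulr0.
have [_ _ D1] := common_prefix I0 I1 e (between1 _ _).
have [_ _ D1'] := common_prefix I0' I1' e' (between1 _ _).
(* The tails after position [q] are shared and the digits at [q] differ by one in both pairs; this
   fixes the distance at depth [q], hence, by affinity, the original one. *)
have x10 : x1 - x0 = x1' - x0'.
  apply: (mulfI (nbetaX_neq0 q)); rewrite -D1 -D1'.
  apply: (mulfI nbeta_neq0).
  move: T0 T1 d d' => /=; rewrite /expansion.
  set y0 := iter q _ x0; set y1 := iter q _ x1.
  set y0' := iter q _ x0'; set y1' := iter q _ x1'.
  rewrite !T_E => T0 T1 d d'; rewrite d d' !intrD in T1.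
  by rewrite !mulrBr; lra.
have x01' : (x' - x0') * (x' - x1') <= 0.
  have -> : x' - x1' = x - x1 by move: x10; rewrite /x'; lra.
  by rewrite /x' addrK.
have [xI ex Dx] := common_prefix I0 I1 e x01.
have [xI' ex' Dx'] := common_prefix I0' I1' e' x01'.
have [Ddig DT] := T_shift (iter q (T_ beta) x) (iter q (T_ beta) x0).
have [Ddig' DT'] := T_shift (iter q (T_ beta) x') (iter q (T_ beta) x0').
have xx : x' - x0' = x - x0 by rewrite /x' addrK.
rewrite Dx' xx in Ddig' DT'; rewrite Dx in Ddig DT.
rewrite -!iterS in Ddig DT Ddig' DT'.
rewrite -T0 in Ddig' DT'.
have Tx : iter q.+1 (T_ beta) x = iter q.+1 (T_ beta) x' by rewrite DT DT'.
split=> // j; case: (ltngtP j q) => jq.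
- by rewrite ex // ex' //; ring.
- have -> : j = (j - q.+1 + q.+1)%N by rewrite subnK.
  by rewrite -!expansion_iter Tx T0; ring.
- by rewrite jq [LHS]Ddig [expansion beta x' q]Ddig' /expansion; ring.
Qed.

(** * Gaps read off from expansions *)

Lemma alt_lt_asym (s t : nat -> int) : alt_lt s t -> ~ alt_lt t s.
Proof.
move=> [i est lti] [j ets ltj].
have neq (a b : nat -> int) n : 0 < (-1) ^+ n.+1 * (a n - b n) -> a n != b n.
  by apply: contraTneq => ->; rewrite subrr mulr0 ltxx.
have ij : i = j.
  case: (ltngtP i j) => // lt_ij.
    by have := neq _ _ _ lti; rewrite ets ?eqxx.
  by have := neq _ _ _ ltj; rewrite est ?eqxx.
by move: lti ltj; rewrite ij -[t j - s j]opprB mulrN oppr_gt0 => /lt_trans h /h; rewrite ltxx.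
Qed.

(** Needed because [is_max] is a relation: two gaps with the same exponent must end in the same
    strings. *)
Lemma is_max_unique k M M' : is_max beta k M -> is_max beta k M' -> M = M'.
Proof.
move=> [SM maxM] [SM' maxM'].
have [//|lt1] := maxM' _ SM; have [//|lt2] := maxM _ SM'.
by case: (alt_lt_asym lt1 lt2).
Qed.

Lemma is_min_unique k m m' : is_min beta k m -> is_min beta k m' -> m = m'.
Proof.
move=> [Sm minm] [Sm' minm'].
have [//|lt1] := minm' _ Sm; have [//|lt2] := minm _ Sm'.
by case: (alt_lt_asym lt1 lt2).
Qed.

(* A leading zero makes the representation stable under padding by zeros. *)
Lemma padded_expansion (w N : seq int) (c : int) (q : nat) :
  ohead w = Some 0 -> admissible beta (pad0 (w ++ c :: N)) -> (size w <= q)%N ->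
  let t := scale (q + size N).+1 (gamma beta (w ++ c :: N)) in
  [/\ central t,
      forall i, (i < q)%N ->
        expansion beta t i = if (i < q - size w)%N then 0 else w`_(i - (q - size w)),
      expansion beta t q = c,
      iter q.+1 (T_ beta) t = scale (size N) (gamma beta N) &
      iter (q + size N).+1 (T_ beta) t = 0].
Proof.
move=> w0 [_ [x xI xE]] wq; set u := w ++ c :: N in xE *; move=> t.
have size_u : size u = (size w + size N).+1 by rewrite size_cat /= addnS.
have [xs Tx] := gamma_expansion xI xE.
have cx : central x.
  split=> //; have := f_equal (fun s => s 0%N) xE.
  rewrite /expansion /= => ->; rewrite /pad0 /u.
  by clear -w0; case: w w0 => //= a w [->].
have cu : central (scale (size u) (gamma beta u)) by rewrite -xs.
have tE : t = scale (size u + (q - size w)) (gamma beta u).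
  by rewrite /t size_u; congr scale; lia.
have [ct Tt] := central_scale (q - size w) cu; rewrite -tE -xs in ct Tt.
have et i : expansion beta t (i + (q - size w)) = u`_i.
  by rewrite -expansion_iter Tt xE.
have tailE : iter q.+1 (T_ beta) t = iter (size w).+1 (T_ beta) x.
  have -> : q.+1 = ((size w).+1 + (q - size w))%N by lia.
  by rewrite iterD Tt.
(* The tail after [c] has expansion [pad0 N], so its value depends on [N] alone, not on [w] or
   [q]. *)
have tail_exp : expansion beta (iter (size w).+1 (T_ beta) x) = pad0 N.
  apply/funext => i; rewrite expansion_iter xE /pad0 /u nth_cat addnS -addSn.
  by rewrite ltnNge leq_addl addnK.
have [tail_val tail_0] := gamma_expansion (iter_T_I _ xI) tail_exp.
split=> //.
- move=> i iq; case: ltnP => iw.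
    by rewrite tE; apply: expansion_central.
  rewrite -{1}(subnK iw) et /u nth_cat; case: ltnP => // ge.
  by move: ge; rewrite leqNgt ltn_subLR // subnK // iq.
- by have := et (size w); rewrite subnKC // /u nth_cat ltnn subnn.
- by rewrite tailE.
- by rewrite addnC -addnS iterD tailE.
Qed.

(** Here [q] is the length of the zero-padded common prefix, and position [q] carries the exponent
    [k]. The end [a] continues with [d - 1] and [b] with [d]; which of them is smaller is left
    open. *)
Definition gap_at (k : nat) (M m : seq int) (a b : R) (L : nat) :=
  exists q, L = (q + k).+1 /\
  let t0 := scale L a in let t1 := scale L b in
  [/\ central t0 /\ central t1,
      (forall i, (i < q)%N -> expansion beta t1 i = expansion beta t0 i) /\
      expansion beta t1 q = expansion beta t0 q + 1,
      iter q.+1 (T_ beta) t0 = scale k (gamma beta M),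
      iter q.+1 (T_ beta) t1 = scale k (gamma beta m) &
      iter L (T_ beta) t0 = 0 /\ iter L (T_ beta) t1 = 0].

(** The leading 0 of [w] allows any amount of zero padding, so gaps with prefixes of different
    lengths can be compared at one common [L]. *)
Lemma gap_exponent_at (z : int -> R) n k : gap_exponent beta z n k ->
  exists M m a b L0,
    [/\ is_max beta k M, is_min beta k m,
        (z n = a /\ z (n + 1) = b) \/ (z n = b /\ z (n + 1) = a) &
        forall L, (L0 <= L)%N -> gap_at k M m a b L].
Proof.
move=> [d [w [M [m [_ [_ w0] [Mmax mmin] [admM admm] zab]]]]].
set a := gamma beta (w ++ _ :: M) in zab; set b := gamma beta (w ++ _ :: m) in zab.
exists M, m, a, b, (size w + k).+1; split=> //.
  have : [set a; b]%classic (z n) by rewrite -zab; left.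
  have : [set a; b]%classic (z (n + 1)) by rewrite -zab; right.
  have : [set z n; z (n + 1)]%classic a by rewrite zab; left.
  have : [set z n; z (n + 1)]%classic b by rewrite zab; right.
  by move=> /= [] h1 [] h2 [] h3 [] h4; rewrite ?h3 ?h4; auto; left; split; congruence.
move=> L leL; exists (L - k.+1)%N.
have eL : L = (L - k.+1 + k).+1 by lia.
split=> //; have [[sM _] _] := Mmax; have [[sm _] _] := mmin.
have wq : (size w <= L - k.+1)%N by lia.
have [c0 e0 d0 v0 z0] := padded_expansion w0 admM wq.
have [c1 e1 d1 v1 z1] := padded_expansion w0 admm wq.
rewrite sM -eL -/a in c0 e0 d0 v0 z0; rewrite sm -eL -/b in c1 e1 d1 v1 z1.
split=> //; split; last by rewrite d0 d1 subrK.
by move=> i iq; rewrite e0 ?e1.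
Qed.

(** Equal exponents give equal tails, and a common [L] gives equal [q], so [cylinder_translation]
    applies. The digit shift [c] does not depend on [y], hence the translation preserves where two
    points of the gap differ. *)
Lemma gap_translation (z : int -> R) n n' k : {homo z : i j / i < j} ->
  gap_exponent beta z n k -> gap_exponent beta z n' k ->
  z (n' + 1) - z n' = z (n + 1) - z n /\
  exists L0, forall L, (L0 <= L)%N -> exists c : nat -> int,
    forall y, z n <= y <= z (n + 1) ->
    let t := scale L y in let t' := scale L (y - z n + z n') in
    [/\ I_ beta t', forall j, expansion beta t j = expansion beta t' j + c j &
        iter L (T_ beta) t = iter L (T_ beta) t'].
Proof.
move=> zmono /gap_exponent_at[M [m [a [b [L0 [Mmax mmin zab gapL]]]]]].
move=> /gap_exponent_at[M' [m' [a' [b' [L0' [Mmax' mmin' zab' gapL']]]]]].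
have eM := is_max_unique Mmax' Mmax; have em := is_min_unique mmin' mmin.
subst M' m'.
have tr L : (maxn L0 L0' <= L)%N -> forall y, (y - a) * (y - b) <= 0 ->
  b - a = b' - a' /\
  [/\ I_ beta (scale L (y - a + a')),
   forall j, expansion beta (scale L y) j =
     expansion beta (scale L (y - a + a')) j +
     (expansion beta (scale L a) j - expansion beta (scale L a') j) &
   iter L (T_ beta) (scale L y) = iter L (T_ beta) (scale L (y - a + a'))].
  rewrite geq_max => /andP[leL leL'] y yab.
  have [q [eL [[[I0 _] [I1 _]] [e d] v0 v1 _]]] := gapL L leL.
  have [q' [eL' [[[I0' _] [I1' _]] [e' d'] v0' v1' _]]] := gapL' L leL'.
  have eq' : q' = q by lia.
  subst q'; rewrite -v0' in v0; rewrite -v1' in v1.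
  have [D _ I' ex Tx] := cylinder_translation I0 I1 I0' I1' e e' d d' v0 v1
    (scale_between L yab).
  rewrite -!scaleB in D; rewrite -scaleB -scaleD in I' ex Tx.
  split; first exact: scale_inj D.
  have iterL t : iter L (T_ beta) t = iter k (T_ beta) (iter q.+1 (T_ beta) t).
    by rewrite eL -addSn addnC iterD.
  by split=> //; rewrite !iterL Tx.
have aab : (a - a) * (a - b) <= 0 by rewrite subrr mul0r.
have [ba _] := tr _ (leqnn _) a aab.
have zn : z n < z (n + 1) by apply: zmono; lia.
have zn' : z n' < z (n' + 1) by apply: zmono; lia.
(* Since [b - a = b' - a'] and [z] increases, both gaps have the same orientation. *)
have [orient za] : z (n' + 1) - z n' = z (n + 1) - z n /\ z n' - z n = a' - a.
  by case: zab zab' => -[? ?] [] [? ?]; split; lra.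
split=> //; exists (maxn L0 L0') => L leL.
exists (fun j => expansion beta (scale L a) j - expansion beta (scale L a') j).
move=> y /andP[y0 y1].
have yab : (y - a) * (y - b) <= 0 by case: zab => -[? ?]; nra.
have [_] := tr L leL y yab.
by have -> : y - z n + z n' = y - a + a' by lra.
Qed.

End Transformation.

(** * From an order-reversing index map to the antimorphism *)

Section Subwords.
Variable v : int -> nat.

Definition subword (a b : int) : seq nat :=
  [seq v (a + Posz i) | i <- iota 0 `|b - a|%N].

Lemma size_subword a b : size (subword a b) = `|b - a|%N.
Proof. by rewrite size_map size_iota. Qed.

Lemma nth_subword x0 a b i : (i < `|b - a|)%N -> nth x0 (subword a b) i = v (a + Posz i).
Proof. by move=> ib; rewrite (nth_map 0%N) ?size_iota // nth_iota. Qed.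

Lemma subwordD (a : int) (N : nat) :
  subword a (a + Posz N) = [seq v (a + Posz i) | i <- iota 0 N].
Proof. by rewrite /subword addrC addKr. Qed.

Lemma subword_cat (a b c : int) : a <= b -> b <= c ->
  subword a b ++ subword b c = subword a c.
Proof.
move=> ab bc; have -> : b = a + Posz (absz (b - a)) by lia.
have -> : c = a + Posz (absz (b - a)) + Posz (absz (c - b)) by lia.
set M := absz (b - a); set N := absz (c - b).
rewrite -[in RHS]addrA -PoszD !subwordD iotaD map_cat add0n.
rewrite (_ : iota M N = map (addn M) (iota 0 N)) -?map_comp; last by rewrite -iotaDl addn0.
by congr (_ ++ _); apply: eq_map => i /=; rewrite PoszD addrA.
Qed.

Lemma subword1 (a : int) : subword a (a + 1) = [:: v a].
Proof. by rewrite (subwordD a 1) /= addr0. Qed.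

(** In the application [g n] is the index of [-beta * z n], and [h n] below that of
    [beta ^ 2 * z n]. *)
Variable g : int -> int.
Hypothesis g0 : g 0 = 0.
Hypothesis g_anti : forall n : int, g (n + 1) < g n.
Hypothesis g_compat : forall n n' : int, v n = v n' ->
  subword (g (n + 1)) (g n) = subword (g (n' + 1)) (g n').
Hypothesis gg_neq : g (g 1) <> 1.

Let h n := g (g n).

Let g_antiD (a : int) (N : nat) : g (a + Posz N) <= g a - Posz N.
Proof.
elim: N => [|N IH]; first by rewrite addr0 subr0.
have -> : a + Posz N.+1 = a + Posz N + 1 by lia.
by have := g_anti (a + Posz N); lia.
Qed.

Let h_monoD (a : int) (N : nat) : h a + Posz N <= h (a + Posz N).
Proof.
have gN := g_antiD a N; rewrite /h.
have := g_antiD (g (a + Posz N)) `|g a - g (a + Posz N)|.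
have -> : g (a + Posz N) + Posz `|g a - g (a + Posz N)|%N = g a by lia.
lia.
Qed.

(** [Phi] sends the factor of [v] from [a] to [b] to the one from [g b] to [g a], so [Psi] sends it
    to the factor from [h a] to [h b]; as [h 0 = 0], the pointed word is fixed. *)
Lemma antimorphism_square_fixpoint :
  exists Phi : seq nat -> seq nat,
    antimorphism Phi /\
    let Psi := Phi \o Phi in
    [/\ morphism Psi, non_erasing Psi, Psi <> id & bi_image Psi v = v].
Proof.
have /choice[phi phiP] k : exists u : seq nat, u != [::] /\
    forall n, v n = k -> u = subword (g (n + 1)) (g n).
  have [[n vn]|nov] := pselect (exists n, v n = k).
    exists (subword (g (n + 1)) (g n)); split; last first.
      by move=> n' vn'; apply: g_compat; rewrite vn vn'.
    by rewrite -size_eq0 size_subword; have := g_anti n; lia.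
  (* A number that is not a letter of [v] may have any nonempty image. *)
  by exists [:: k]; split=> // n vn; case: nov; exists n.
pose Phi (u : seq nat) := flatten [seq phi k | k <- rev u].
have PhiA : antimorphism Phi by move=> u w; rewrite /Phi rev_cat map_cat flatten_cat.
have Phi1 k : Phi [:: k] = phi k by rewrite /Phi /= cats0.
have PhiF (a : int) (N : nat) : Phi (subword a (a + Posz N)) = subword (g (a + Posz N)) (g a).
  elim: N => [|N IH]; first by rewrite addr0 /subword !subrr.
  have -> : a + Posz N.+1 = a + Posz N + 1 by lia.
  rewrite -(@subword_cat _ (a + Posz N)); [|lia|lia].
  rewrite PhiA IH subword1 Phi1 ((phiP _).2 (a + Posz N) erefl) subword_cat //.
    by have := g_anti (a + Posz N); lia.
  by have := g_antiD a N; lia.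
pose Psi := Phi \o Phi.
have PsiM : morphism Psi by move=> u w; rewrite /Psi /= !PhiA.
have Psi0 : Psi [::] = [::] by [].
have PsiF (a : int) (N : nat) : Psi (subword a (a + Posz N)) = subword (h a) (h (a + Posz N)).
  rewrite /Psi /= PhiF; have gN := g_antiD a N.
  have := PhiF (g (a + Posz N)) `|g a - g (a + Posz N)|%N.
  by have -> : g (a + Posz N) + Posz `|g a - g (a + Posz N)|%N = g a by lia.
have Psi_flatten (s : seq int) : flatten [seq Psi [:: v i] | i <- s] = Psi (map v s).
  by elim: s => // i s IH; rewrite -[map v _]cat1s PsiM -IH.
have h0 : h 0 = 0 by rewrite /h !g0.
exists Phi; split=> //; split=> //.
- have Phi_neq0 u : u != [::] -> Phi u != [::].
    case: u => // k u _; rewrite -cat1s PhiA -size_eq0 size_cat Phi1 addn_eq0.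
    by rewrite [X in _ && X]size_eq0 (negPf (phiP k).1) andbF.
  by move=> k; do 2 apply: (Phi_neq0).
(* Otherwise the image of the single letter [v 0] has length [h 1 = 1]. *)
- move=> PsiId; have := PsiF 0 1%N; rewrite /Psi PsiId => /(f_equal size).
  rewrite !size_subword h0; have := h_monoD 0 1; rewrite h0 /h !add0r => h1 h2.
  have g1 : g (g (Posz 1)) <> 1 := gg_neq.
  by apply: g1; lia.
- apply/funext => -[] m.
    have -> : bi_image Psi v (Posz m) =
        nth (v (Posz m)) (flatten [seq Psi [:: v i] | i <- map Posz (iota 0 m.+1)]) m.
      by rewrite -map_comp.
    rewrite Psi_flatten -map_comp (_ : map _ _ = subword 0 (0 + Posz m.+1)); last first.
      by rewrite subwordD; apply: eq_map => i /=; rewrite add0r.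
    (* The image reaches up to [h (m + 1) >= m + 1], so position [m] lies inside it. *)
    have := h_monoD 0 m.+1; rewrite PsiF h0 !add0r => hm.
    by rewrite nth_subword ?add0r //; lia.
  have -> : bi_image Psi v (Negz m) = nth (v (Negz m)) (rev (flatten
      [seq Psi [:: v i] | i <- map Negz (rev (iota 0 m.+1))])) m.
    by rewrite -map_comp.
  have -> : map Negz (rev (iota 0 m.+1)) =
      [seq Negz m + Posz i | i <- iota 0 m.+1].
    apply: (@eq_from_nth _ 0) => [|i]; first by rewrite !size_map size_rev.
    rewrite size_map size_rev size_iota => im.
    rewrite !(nth_map 0%N) ?size_rev ?size_iota // nth_rev ?size_iota //.
    by rewrite !nth_iota; lia.
  rewrite Psi_flatten -map_comp (_ : map _ _ = subword (Negz m) (Negz m + Posz m.+1)).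
    have m0 : Negz m + Posz m.+1 = 0 by lia.
    (* The image ends at index 0, so entry [m] of its reversal is the letter at [-(m + 1)]. *)
    have := h_monoD (Negz m) m.+1; rewrite PsiF m0 h0 => hm.
    rewrite nth_rev size_subword; last by lia.
    by rewrite nth_subword; [congr v; lia|lia].
  by rewrite subwordD.
Qed.

End Subwords.

(** * Images of gaps under multiplication by [-beta] *)

Section GapImages.
Context {R : realType}.
Variable beta : R.
Hypothesis beta_gt1 : 1 < beta.
Variables (z : int -> R) (v : int -> nat).
Hypothesis z_enum : enumerates_beta_integers beta z.
Hypothesis z_gap : forall n, gap_exponent beta z n (v n).

Let z_le : {mono z : i j / i <= j}.
Proof. by case: z_enum => zmono _ _; exact: le_mono zmono. Qed.

Let z_lt : {mono z : i j / i < j}.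
Proof. exact: leW_mono z_le. Qed.

Let z_mem x : beta_integers beta x -> exists i, z i = x.
Proof. by case: z_enum => _ _ <- [i _ <-]; exists i. Qed.

Let nbeta_neq0 : - beta != 0.
Proof. by have b1 := beta_gt1; rewrite lt_eqF //; lra. Qed.

(** Characterizes [v n] by digits alone: position [L.-1 - v n], of exponent [v n], is the first
    where the two ends differ. *)
Lemma gap_exponent_large n : exists L0, forall L, (L0 <= L)%N ->
  [/\ (v n < L)%N, central beta (scale beta L (z n)),
      iter L (T_ beta) (scale beta L (z n)) = 0,
      forall j, (j < L.-1 - v n)%N ->
        expansion beta (scale beta L (z n)) j = expansion beta (scale beta L (z (n + 1))) j &
      expansion beta (scale beta L (z n)) (L.-1 - v n) <>
        expansion beta (scale beta L (z (n + 1))) (L.-1 - v n)].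
Proof.
have [M [m [a [b [L0 [_ _ zab gapL]]]]]] := gap_exponent_at beta_gt1 (z_gap n).
exists L0 => L /gapL[q [eL [[c0 c1] [e d] _ _ [Z0 Z1]]]].
have qE : (L.-1 - v n = q)%N by rewrite eL addnK.
rewrite qE; have vL : (v n < L)%N by rewrite eL ltnS leq_addl.
have ab_neq : expansion beta (scale beta L a) q <> expansion beta (scale beta L b) q.
  by rewrite d; lia.
case: zab => -[-> ->]; split=> //; first by move=> j /e.
by move/esym.
Qed.

Lemma image_index n : exists m, z m = - beta * z n.
Proof.
have [L0 /(_ L0 (leqnn _))[vL [I0 _] T0 _ _]] := gap_exponent_large n.
apply/z_mem/(mem_beta_integers beta_gt1 (L := L0.+1)) => //.
  by rewrite scaleS.
by rewrite scaleS //= T0; exact: (iter_T0 beta_gt1 1).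
Qed.

(** Divide by [-beta] to land in gap [n], translate to gap [n'], and multiply back. *)
Lemma image_translation n n' i : v n = v n' ->
  - beta * z (n + 1) <= z i <= - beta * z n ->
  exists j, z j = z i - beta * (z n' - z n).
Proof.
move=> vn /andP[zi0 zi1]; have b1 := beta_gt1.
have zmono : {homo z : i j / i < j} by case: z_enum.
have gap' := z_gap n'; rewrite -vn in gap'.
have [_ [L0 tr]] := gap_translation beta_gt1 zmono (z_gap n) gap'.
have [L1 large] := gap_exponent_large i.
have [c trc] := tr (maxn L0 L1) (leq_maxl _ _).
set L := maxn L0 L1 in trc.
(* [y] need not be a beta-integer: at scale [L] it is [z i] at scale [L.+1], so its orbit reaches 0
   only after [L.+1] steps. *)
have [_ _ Ti _ _] := large L.+1 (leqW (leq_maxr _ _)).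
pose y := z i / - beta.
have yE : - beta * y = z i by rewrite /y mulrCA divff ?mulr1.
have yn : z n <= y <= z (n + 1) by apply/andP; split; nra.
have [I' _ T'] := trc y yn.
have -> : z i - beta * (z n' - z n) = - beta * (y - z n + z n') by rewrite -yE; ring.
apply: z_mem; apply: (mem_beta_integers beta_gt1 (L := L.+1)); rewrite ?scaleS //.
by rewrite iterS -T' -iterS -(scaleS beta_gt1) yE.
Qed.

(** Both neighbours undergo the same digit shift [c], so each pair first differs at the same
    position. *)
Lemma image_exponent n n' i j : v n = v n' ->
  - beta * z (n + 1) <= z i -> z (i + 1) <= - beta * z n ->
  z j = z i - beta * (z n' - z n) ->
  z (j + 1) = z (i + 1) - beta * (z n' - z n) ->
  v i = v j.
Proof.
move=> vn zi0 zi1 zj zj1; have b1 := beta_gt1.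
have zmono : {homo z : i j / i < j} by case: z_enum.
have gap' := z_gap n'; rewrite -vn in gap'.
have [_ [L0 tr]] := gap_translation beta_gt1 zmono (z_gap n) gap'.
have [L1 large] := gap_exponent_large i.
have [L2 large'] := gap_exponent_large j.
pose L := (L0 + L1 + L2)%N.
have [|c trc] := tr L; first by rewrite /L; lia.
have [|vi _ _ ei di] := large L.+1; first by rewrite /L; lia.
have [|vj _ _ ej dj] := large' L.+1; first by rewrite /L; lia.
have lt_i : z i < z (i + 1) by rewrite z_lt; lia.
pose y k := z k / - beta.
have yE k : - beta * y k = z k by rewrite /y mulrCA divff ?mulr1.
have yi : z n <= y i <= z (n + 1) by have := yE i; move=> h; apply/andP; split; nra.
have yi1 : z n <= y (i + 1) <= z (n + 1).
  by have := yE (i + 1); move=> h; apply/andP; split; nra.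
have [_ e0 _] := trc _ yi; have [_ e1 _] := trc _ yi1.
have sE k : scale beta L (y k) = scale beta L.+1 (z k) by rewrite -scaleS // yE.
have sE' k l : z l = z k - beta * (z n' - z n) ->
    scale beta L (y k - z n + z n') = scale beta L.+1 (z l).
  by move=> ->; rewrite -(yE k) -scaleS //; congr scale; ring.
rewrite sE (sE' _ _ zj) in e0; rewrite sE (sE' _ _ zj1) in e1.
rewrite /= in ei ej di dj.
have e01 l : expansion beta (scale beta L.+1 (z i)) l =
    expansion beta (scale beta L.+1 (z (i + 1))) l <->
  expansion beta (scale beta L.+1 (z j)) l =
    expansion beta (scale beta L.+1 (z (j + 1))) l.
  by rewrite e0 e1; split=> [/addIr|->].
(* The larger exponent sits at an earlier position, where the other pair still agrees. *)
case: (ltngtP (v i) (v j)) => // lt_v.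
- by case: dj; apply/e01; apply: ei; lia.
- by case: di; apply/e01; apply: ej; lia.
Qed.

Variable g : int -> int.
Hypothesis zg : forall n, z (g n) = - beta * z n.

Lemma image_decreasing (n : int) : g (n + 1) < g n.
Proof.
have b1 := beta_gt1; have zn : z n < z (n + 1) by rewrite z_lt; lia.
by rewrite -z_lt !zg; nra.
Qed.

(** Translation by [s] is a bijection between the beta-integers of the two images, so it matches
    consecutive ones, and [image_exponent] matches the letters. *)
Lemma image_gap_word (n n' : int) : v n = v n' ->
  subword v (g (n + 1)) (g n) = subword v (g (n' + 1)) (g n').
Proof.
move=> vn; have b1 := beta_gt1.
have zmono : {homo z : i j / i < j} by case: z_enum.
have gap' := z_gap n'; rewrite -vn in gap'.
have [dz _] := gap_translation beta_gt1 zmono (z_gap n) gap'.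
set p := g (n + 1); set q := g n; set p' := g (n' + 1); set q' := g n'.
have zp : z p = - beta * z (n + 1) by exact: zg.
have zq : z q = - beta * z n by exact: zg.
pose s := - beta * (z n' - z n).
have zp' : z p' = z p + s by rewrite /p' zp zg /s -mulrDr; congr (_ * _); lra.
have zq' : z q' = z q + s by rewrite /q' zq zg /s; ring.
have fwd i : p <= i <= q -> exists j, z j = z i + s.
  move=> /andP[pi iq]; have [|j zj] := @image_translation n n' i vn.
    by rewrite -zp -zq !z_le pi.
  by exists j; rewrite zj /s; ring.
have bwd j : p' <= j <= q' -> exists i, z i = z j - s.
  move=> /andP[pj jq]; have [|i zi] := @image_translation n' n j (esym vn).
    by rewrite -!zg !z_le pj.
  by exists i; rewrite zi /s; ring.
have pq : p < q by exact: image_decreasing.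
(* Induction along the image: [fwd] bounds the next point on the primed side from above, and [bwd]
   bounds it from below, so no beta-integer is skipped. *)
have shift (N : nat) : p + Posz N <= q -> z (p' + Posz N) = z (p + Posz N) + s.
  elim: N => [|N IH] Nq; first by rewrite !addr0.
  have {}IH : z (p' + Posz N) = z (p + Posz N) + s by apply: IH; lia.
  have [|j zj] := fwd (p + Posz N.+1); first by lia.
  have lej : p' + Posz N.+1 <= j.
    have : p' + Posz N < j by rewrite -z_lt zj IH ltrD2r z_lt; lia.
    by lia.
  have leq' : p' + Posz N.+1 <= q'.
    by rewrite -z_le zq'; apply: le_trans (_ : z j <= _);
      [rewrite z_le | rewrite zj lerD2r z_le].
  have [|i zi] := bwd (p' + Posz N.+1); first by apply/andP; split; lia.
  have lei : p + Posz N.+1 <= i.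
    have : p + Posz N < i.
      by rewrite -z_lt zi -(addrK s (z (p + _))) -IH ltrD2r z_lt; lia.
    by lia.
  apply: le_anti; rewrite -{1}zj -lerBrDr -zi !z_le lei andbT.
  by [].
have size_eq : q' = p' + Posz `|q - p|%N.
  have z_inj : injective z by apply: inc_inj => i j; rewrite z_le.
  apply: z_inj; rewrite zq' shift; last by lia.
  by congr (z _ + _); lia.
have -> : q = p + Posz `|q - p|%N by lia.
rewrite size_eq !subwordD; apply/eq_in_map => i.
rewrite mem_iota /= add0n => iN.
apply: (image_exponent vn).
- by rewrite -zp z_le; lia.
- by rewrite -zq z_le; lia.
- by rewrite shift /s ?mulNr //; lia.
- have eD (a : int) : a + Posz i + 1 = a + Posz i.+1 by lia.
  by rewrite !eD shift /s ?mulNr //; lia.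
Qed.

End GapImages.

Theorem theorem6p1 (R : realType) (beta : R)
    (hbeta : (1 + Num.sqrt 5) / 2 <= beta)
    (v : int -> nat) (hv : is_word_of_beta_integers beta v) :
  exists Phi : seq nat -> seq nat,
    antimorphism Phi /\
    let Psi := Phi \o Phi in
    [/\ morphism Psi, non_erasing Psi, Psi <> id & bi_image Psi v = v].
Proof.
have beta_gt1 : 1 < beta.
  apply: lt_le_trans hbeta; have : 1 < Num.sqrt 5 :> R; last by lra.
  by rewrite -[X in X < _]sqrtr1 ltr_sqrt //; lra.
have [z z_enum z_gap] := hv; have [zmono z0 _] := z_enum.
have z_inj : injective z by apply: inc_inj; exact: le_mono zmono.
have /choice[g zg] := image_index beta_gt1 z_enum z_gap.
apply: (@antimorphism_square_fixpoint v g).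
- by apply: z_inj; rewrite zg z0 mulr0.
- by move=> n; exact (image_decreasing beta_gt1 z_enum zg n).
- by move=> n n'; exact (image_gap_word beta_gt1 z_enum z_gap zg (n' := n')).
(* A fixed index 1 would give [beta ^ 2 * z 1 = z 1] with [z 1 > 0]. *)
- move=> gg1; have : z (g (g 1)) = z 1 by rewrite gg1.
  have z1 : 0 < z 1 by rewrite -z0; apply: zmono.
  have : 0 < (beta * beta - 1) * z 1 by apply: mulr_gt0 => //; nra.
  by rewrite !zg; lra.
Qed.
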